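(* Let $\{\xi_1,\xi_2,\dots\}$ be independent real-valued random variables (not necessarily identically distributed), with distribution functions $F_{\xi_1},F_{\xi_2},\dots$ and tails $\overline{F}_{\xi_k}=1-F_{\xi_k}$, and let $\eta$ be a counting random variable independent of $\{\xi_1,\xi_2,\dots\}$. Let $S_0=0$, $S_n=\xi_1+\dots+\xi_n$ for $n\geqslant 1$, and let $S_{(\eta)}=\max\{S_0,S_1,\dots,S_\eta\}$ be the randomly stopped maximum of sums. Suppose that the following conditions hold: (a) $F_{\xi_k}\in\mathcal{C}$ for each $k\in\mathbb{N}$; (b) $$\limsup_{x\to\infty}\ \sup_{n\geqslant 1}\ \frac{1}{n\,\overline{F}_{\xi_1}(x)}\sum_{k=1}^{n}\overline{F}_{\xi_k}(x)<\infty;$$ (c) $\mathbb{E}\eta^{p+1}<\infty$ for some $p>J^+_{F_{\xi_1}}$. Then the distribution function $F_{S_{(\eta)}}$ of $S_{(\eta)}$ belongs to the class $\mathcal{C}$.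
   Context: A counting random variable is an integer-valued, nonnegative random variable that is nondegenerate at zero (i.e. $\mathbb{P}(\eta=0)<1$). ''$\eta$ independent of $\{\xi_1,\xi_2,\dots\}$'' means that $\eta$ is independent of the whole sequence. For a distribution function $F$ write $\overline{F}(x)=1-F(x)$. The class $\mathcal{C}$ of consistently varying distributions consists of the distribution functions $F$ (on $\mathbb{R}$, with $\overline F(x)>0$ for all $x$, so that the ratios make sense) such that $$\lim_{y\uparrow 1}\ \limsup_{x\to\infty}\frac{\overline{F}(xy)}{\overline{F}(x)}=1.$$ The upper Matuszewska index of a distribution function $F$ is $$J_F^+=-\lim_{y\to\infty}\frac{1}{\log y}\log\left(\liminf_{x\to\infty}\frac{\overline{F}(xy)}{\overline{F}(x)}\right).$$ *)

(* Defs.v *)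
From HB Require Import structures.
From mathcomp Require Import all_boot all_order all_algebra finmap.
From mathcomp Require Import all_classical all_reals all_analysis.
From mathcomp Require Import measurable_realfun.

Set Implicit Arguments.
Unset Strict Implicit.
Unset Printing Implicit Defensive.

Import Order.TTheory GRing.Theory Num.Theory.
Import numFieldNormedType.Exports.

Local Open Scope classical_set_scope.
Local Open Scope ring_scope.

Section DistributionFunctions.
Local Open Scope ereal_scope.
Context {R : realType}.

(* Distribution functions take values in the extended reals, as the library's
   cdf does; the values actually lie in [0, 1]. *)
Definition distribution_function (F : R -> \bar R) : Prop :=
  [/\ nondecreasing_fun F, right_continuous F,
      F x @[x --> -oo%R] --> 0 & F x @[x --> +oo%R] --> 1].

Definition tail (F : R -> \bar R) (x : R) : \bar R := 1 - F x.

Definition tail_ratio (F : R -> \bar R) (y x : R) : \bar R :=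
  tail F (x * y) / tail F x.

Definition class_C (F : R -> \bar R) : Prop :=
  [/\ distribution_function F,
      forall x, 0 < tail F x &
      limf_esup (tail_ratio F y) +oo%R @[y --> 1^'-] --> 1].

(* The logarithm is the extended one, lne 0 = -oo, so that a vanishing lower
   limit gives the index +oo. *)
Definition upper_Matuszewska (F : R -> \bar R) : \bar R :=
  - lim ((ln y)^-1%:E * lne (limf_einf (tail_ratio F y) +oo%R) @[y --> +oo%R]).

End DistributionFunctions.

Section Independence.
Context {d : measure_display} {T : measurableType d} {R : realType}.
Context (P : probability T R).

Definition mutually_independent (xi : nat -> {RV P >-> R}) : Prop :=
  forall (J : {fset nat}) (A : nat -> set R),
    (forall k, measurable (A k)) ->
    P (\bigcap_(k in [set` J]) (xi k @^-1` A k)) =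
    (\prod_(k <- J) fine (P (xi k @^-1` A k)))%:E.

Definition sigma_sequence (xi : nat -> {RV P >-> R}) : set (set T) :=
  <<s \bigcup_k preimage_set_system setT (xi k) measurable >>.

Definition independent_of_sequence
    (eta : {RV P >-> nat}) (xi : nat -> {RV P >-> R}) : Prop :=
  forall (B : set nat) (A : set T), measurable B -> sigma_sequence xi A ->
    P (eta @^-1` B `&` A) = (P (eta @^-1` B) * P A)%E.

(* Integrality and nonnegativity are carried by the codomain nat. *)
Definition counting_rv (eta : {RV P >-> nat}) : Prop :=
  (P [set t | eta t = 0%N] < 1)%E.

End Independence.

Section StoppedMaximum.
Context {d : measure_display} {T : measurableType d} {R : realType}.
Implicit Types (xi : nat -> {mfun T >-> R}) (eta : {mfun T >-> nat}).

(* Sequences are indexed from 0: xi k stands for the (k+1)-st summand. *)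
Definition partial_sum xi (n : nat) (t : T) : R := \sum_(k < n) xi k t.

(* The initial value 0 is harmless since partial_sum xi 0 = 0. *)
Definition max_partial_sum xi (n : nat) (t : T) : R :=
  \big[Num.max/0]_(k < n.+1) partial_sum xi k t.

Definition stopped_max_fun xi eta (t : T) : R := max_partial_sum xi (eta t) t.

Lemma measurable_max_partial_sum xi n :
  measurable_fun setT (max_partial_sum xi n).
Proof.
rewrite /max_partial_sum; elim: (index_enum _) => [|k s ih].
  by under eq_fun do rewrite big_nil; exact: measurable_cst.
under eq_fun do rewrite big_cons.
apply: measurable_maxr => //.
by rewrite /partial_sum; apply: measurable_sum => j.
Qed.

Lemma measurable_stopped_max_fun xi eta :
  measurable_fun setT (stopped_max_fun xi eta).
Proof.
move=> _ B mB; rewrite setTI.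
have -> : stopped_max_fun xi eta @^-1` B =
    \bigcup_n (eta @^-1` [set n] `&` max_partial_sum xi n @^-1` B).
  apply/seteqP; split => [t Bt | t [n _ [/= <- //]]].
  by exists (eta t).
apply: bigcup_measurable => n _; apply: measurableI.
  by rewrite -[X in measurable X]setTI; exact: measurable_funP.
by rewrite -[X in measurable X]setTI; exact: measurable_max_partial_sum.
Qed.

HB.instance Definition _ xi eta :=
  isMeasurableFun.Build _ _ T R (stopped_max_fun xi eta)
    (measurable_stopped_max_fun xi eta).

End StoppedMaximum.

Definition stopped_max (d : measure_display) (T : measurableType d)
    (R : realType) (P : probability T R)
    (xi : nat -> {RV P >-> R}) (eta : {RV P >-> nat}) : {RV P >-> R} :=
  stopped_max_fun xi eta.

(* Main.v *)
Require Import Defs.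
From HB Require Import structures.
From mathcomp Require Import all_boot all_order all_algebra finmap.
From mathcomp Require Import all_classical all_reals all_analysis.
From mathcomp Require Import ring lra.

Import Order.TTheory GRing.Theory Num.Theory.
Import numFieldNormedType.Exports.

Local Open Scope classical_set_scope.
Local Open Scope ring_scope.

(* Consistent variation of a tail G means that G (x y) <= r G x for large x, for
   each r > 1 and y < 1 close to 1.  Write G_k for the tail of xi_k.  For fixed n
   the tail H_n of max(S_0, ..., S_n) is equivalent to the sum of the G_k, k < n,
   by the one-big-jump principle, so H_n is consistently varying.  By the union
   bound, H_n x <= sum_k G_k (x / n), which by (b) and the Matuszewska index is at
   most C n^(p+1) G_0 x uniformly in n; the moment condition (c) then makes the
   contribution of eta >= K to the tail of the stopped maximum at most eps G_0,
   while that tail itself dominates P(eta <> 0) G_0 because S_1 = xi_1.  So it is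
   a finite mixture of the H_n up to a relatively small error. *)

(** * Consistently varying functions *)

Definition consistently_varying {R : realType} (G : R -> R) :=
  forall r : R, 1 < r ->
    \forall y \near 1^'-, \forall x \near +oo, G (x * y) <= r * G x.

Section ConsistentVariation.
Context {R : realType}.
Implicit Types (G H : R -> R) (r x y : R).

Lemma near_pinfty_mull (a : R) (Q : R -> Prop) : 0 < a ->
  (\forall x \near +oo, Q x) -> \forall x \near +oo, Q (x * a).
Proof.
move=> a0 hQ; have : (fun x : R => x * a) @ +oo --> +oo.
  by apply: gt0_cvgMly => //; exact: cvg_id.
exact.
Qed.

Lemma near_pinfty_ge (Q : R -> Prop) :
  (\forall x \near +oo, Q x) -> \forall a \near +oo, forall x, a <= x -> Q x.
Proof.
move=> [M [Mr hM]]; exists M; split=> // a Ma x ax.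
by apply: hM; exact: lt_le_trans ax.
Qed.

Lemma consistently_varyingD G H :
  consistently_varying G -> consistently_varying H ->
  consistently_varying (fun x => G x + H x).
Proof.
move=> hG hH r r1.
near=> y.
have yG : \forall x \near +oo, G (x * y) <= r * G x by near: y; exact: hG.
have yH : \forall x \near +oo, H (x * y) <= r * H x by near: y; exact: hH.
near=> x; rewrite mulrDr lerD//; near: x; [exact: yG|exact: yH].
Unshelve. all: by end_near. Qed.

Lemma consistently_varyingZ (a : R) G : 0 <= a ->
  consistently_varying G -> consistently_varying (fun x => a * G x).
Proof.
move=> a0 hG r r1.
near=> y.
have yG : \forall x \near +oo, G (x * y) <= r * G x by near: y; exact: hG.
near=> x; rewrite mulrCA ler_wpM2l//; near: x; exact: yG.
Unshelve. all: by end_near. Qed.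

Lemma consistently_varying0 : consistently_varying (fun=> 0 : R).
Proof. by move=> r r1; near=> y; near=> x; rewrite mulr0.
Unshelve. all: by end_near. Qed.

Lemma consistently_varying_sum (G : nat -> R -> R) n :
  (forall k, consistently_varying (G k)) ->
  consistently_varying (fun x => \sum_(k < n) G k x).
Proof.
move=> hG; elim: n => [|n IH].
  under eq_fun do rewrite big_ord0; exact: consistently_varying0.
under eq_fun do rewrite big_ord_recr/=; exact: consistently_varyingD.
Qed.

Lemma near_eq_consistently_varying G H :
  (\forall x \near +oo, G x = H x) ->
  consistently_varying G -> consistently_varying H.
Proof.
move=> GH hG r r1.
near=> y.
have y0 : 0 < y by near: y; exact: nbhs_left_gt.
have yG : \forall x \near +oo, G (x * y) <= r * G x by near: y; exact: hG.
near=> x.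
have <- : G x = H x by near: x.
have <- : G (x * y) = H (x * y).
  by near: x; exact: (@near_pinfty_mull y (fun x => G x = H x)).
by near: x.
Unshelve. all: by end_near. Qed.

Lemma asymp_equiv_consistently_varying G H :
  (forall r, 1 < r -> \forall x \near +oo, H x <= r * G x) ->
  (forall r, 1 < r -> \forall x \near +oo, G x <= r * H x) ->
  consistently_varying G -> consistently_varying H.
Proof.
move=> HG GH hG r r1.
have sqrt_gt1 (u : R) : 1 < u -> 1 < Num.sqrt u by move=> ?; rewrite -sqrtr1 ltr_sqrt //; lra.
(* Passing from [H (x * y)] to [G (x * y)], then to [G x], then to [H x] costs three factors [s].
   The fourth is slack, so a double square root suffices. *)
pose s := Num.sqrt (Num.sqrt r).
have s1 : 1 < s by rewrite !sqrt_gt1.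
have rE : s * s * s * s = r.
  have e1 : s * s = Num.sqrt r by rewrite -expr2 sqr_sqrtr// sqrtr_ge0.
  by rewrite -mulrA e1 -expr2 sqr_sqrtr//; lra.
near=> y.
have y0 : 0 < y by near: y; exact: nbhs_left_gt.
have yG : \forall x \near +oo, G (x * y) <= s * G x by near: y; exact: hG.
near=> x.
have h1 : H (x * y) <= s * G (x * y).
  near: x; apply: (@near_pinfty_mull y (fun x => H x <= s * G x)) => //.
  exact: HG.
have h2 : G (x * y) <= s * G x by near: x.
have h3 : G x <= s * H x by near: x; exact: GH.
have h4 : H x <= s * G x by near: x; exact: HG.
(* Chaining [h4] and [h3] gives [H x <= s * s * H x] with [s * s > 1], which forces the sign. *)
have Hx0 : 0 <= H x.
  have ss : 0 < s * s - 1 by nra.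
  by rewrite -(pmulr_rge0 _ ss); nra.
have h5 : G (x * y) <= s * (s * H x) by apply: (le_trans h2); rewrite ler_pM2l//; lra.
apply: (le_trans h1); apply: (@le_trans _ _ (s * (s * (s * H x)))).
  by rewrite ler_pM2l//; lra.
by rewrite -rE !mulrA ler_wpM2r// ler_peMr ?ltW// !mulr_gt0//; lra.
Unshelve. all: by end_near. Qed.

(** Consistent variation implies dominated variation. Some [y < 1] costs at most a factor 2; after
    [m] steps, with [y ^+ m <= a], monotonicity gives the bound with [C = 2 ^+ m]. *)
Lemma consistently_varying_dominated G (a : R) : 0 < a ->
  {homo G : x y /~ x <= y} -> consistently_varying G ->
  exists2 C, 0 < C & \forall x \near +oo, G (x * a) <= C * G x.
Proof.
move=> a0 Gni hG.
have : exists2 y, 0 < y < 1 & \forall x \near +oo, G (x * y) <= 2 * G x.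
  have /filter_ex[y [y01 yG]] : \forall y \near 1^'-, 0 < y < 1 /\
      \forall x \near +oo, G (x * y) <= 2 * G x.
    near=> y; split; last by near: y; apply: hG; lra.
    by apply/andP; split; near: y; [exact: nbhs_left_gt|exact: nbhs_left_lt].
  by exists y.
move=> [y /andP[y0 y1] yG].
have iter m : \forall x \near +oo, G (x * y ^+ m) <= 2 ^+ m * G x.
  elim: m => [|m IH]; first by near=> x; rewrite !expr0 mulr1 mul1r.
  near=> x; rewrite exprSr mulrA (@le_trans _ _ (2 * G (x * y ^+ m)))//.
    near: x; apply: (@near_pinfty_mull _ (fun x => G (x * y) <= 2 * G x)) => //.
    exact: exprn_gt0.
  by rewrite exprS -mulrA ler_pM2l//; near: x.
have [m ym] : exists m, y ^+ m <= a.
  have : (GRing.exp y) @ \oo --> (0 : R) by apply: cvg_expr; rewrite gtr0_norm.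
  move=> /cvgrPdist_lt/(_ _ a0)[m _ /(_ m (leqnn m))/=].
  rewrite sub0r normrN ger0_norm ?exprn_ge0 1?ltW// => /ltW h.
  by exists m.
exists (2 ^+ m); first exact: exprn_gt0.
near=> x.
have x0 : 0 < x by near: x; exact: nbhs_pinfty_gt.
apply: (@le_trans _ _ (G (x * y ^+ m))); last by near: x.
by apply: Gni; rewrite ler_pM2l.
Unshelve. all: by end_near. Qed.

(** A Potter-type bound from a single scale [y]: each multiplication of the argument by [y] costs
    [y]^ p[, and about]ln z / ln y[of them reach]x * z[. The constant]c = y [^ p] pays for the last,
    incomplete step. The points visited only move to the right, so one threshold [a] serves all
    [z]. *)
Lemma powR_tail_bound G (p y : R) : 1 < y -> 0 < p ->
  {homo G : x y /~ x <= y} -> (forall x, 0 < G x) ->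
  (\forall x \near +oo, y `^ (- p) * G x <= G (x * y)) ->
  exists2 c, 0 < c & \forall a \near +oo, forall (x z : R), a <= x -> 1 <= z ->
    G x <= c * z `^ p * G (x * z).
Proof.
move=> y1 p0 Gni G0 yG; exists (y `^ p); first by rewrite powR_gt0//; lra.
have y0 : 0 < y by lra.
near=> a => x z ax z1.
have a0 : 0 < a by near: a; exact: nbhs_pinfty_gt.
have yGa u : a <= u -> G u <= y `^ p * G (u * y).
  move=> au; rewrite -ler_pdivrMl ?powR_gt0// -powRN.
  by move: u au; near: a; exact: near_pinfty_ge.
have [m zm] : exists m, z <= y ^+ m.
  have : GRing.exp y^-1 @ \oo --> (0 : R).
    by apply: cvg_expr; rewrite gtr0_norm ?invr_gt0// invf_lt1.
  have z0 : 0 < z by lra.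
  move=> /cvgrPdist_lt/(_ z^-1); rewrite invr_gt0 => /(_ z0)[m _ /(_ m (leqnn m))/=].
  rewrite sub0r normrN ger0_norm ?exprn_ge0 ?invr_ge0 ?ltW// => h.
  by exists m; rewrite -lef_pV2 ?posrE ?exprn_gt0// -exprVn ltW.
have yp1 : 1 <= y `^ p by rewrite -(powRr0 y) ler_powR; lra.
elim: m x z ax z1 zm => [|m IH] x z ax z1 zm.
  have -> : z = 1 by apply/eqP; rewrite eq_le z1 -(expr0 y) zm.
  by rewrite powR1 !mulr1 ler_peMl// ltW.
have x0 : 0 < x by lra.
have [zy|yz] := leP z y.
  apply: (le_trans (yGa x ax)).
  have zp1 : 1 <= z `^ p by rewrite -(powRr0 z) ler_powR// ltW.
  have zy' : G (x * y) <= G (x * z) by apply: Gni; rewrite ler_pM2l.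
  have g0 := G0 (x * z); have g1 := G0 (x * y).
  rewrite -mulrA ler_pM2l ?powR_gt0//; nra.
apply: (le_trans (yGa x ax)).
have := IH (x * y) (z / y).
have -> : x * y * (z / y) = x * z by field; lra.
rewrite ler_pdivlMr// mul1r ler_pdivrMr// -exprSr => h.
have {}h := h _ (ltW yz) zm.
rewrite -mulrA ler_pM2l ?powR_gt0//.
have <- : y `^ p * (z / y) `^ p = z `^ p.
  by rewrite -powRM ?divr_ge0 1?mulrC ?divfK//; lra.
by apply: h; nra.
Unshelve. all: by end_near. Qed.

End ConsistentVariation.

(** * Class C and the upper Matuszewska index *)

Section LimitsSuperiorInferior.
Context {R : realType}.
Implicit Types (f : R -> \bar R) (a : \bar R).
Local Open Scope ereal_scope.

Lemma limf_esup_lt_near f a : limf_esup f +oo%R < a ->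
  \forall x \near +oo%R, f x < a.
Proof.
move=> /ereal_inf_lt[_ [V FV <-]] h.
near=> x; apply: le_lt_trans h; apply: ereal_sup_ubound; exists x => //.
by near: x.
Unshelve. all: by end_near. Qed.

Lemma near_limf_esup_le f a : (\forall x \near +oo%R, f x <= a) ->
  limf_esup f +oo%R <= a.
Proof.
move=> h; apply: ge_ereal_inf; exists (ereal_sup (f @` [set x | f x <= a])).
  by exists [set x | f x <= a].
by apply: ge_ereal_sup => _ [x /= xa <-].
Qed.

Lemma near_limf_esup_ge f a : (\forall x \near +oo%R, a <= f x) ->
  a <= limf_esup f +oo%R.
Proof.
move=> h; apply: le_ereal_inf_tmp => _ [V FV <-].
have /filter_ex[x [Vx ax]] : \forall x \near +oo%R, V x /\ a <= f x.
  by near=> x; split; near: x.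
by apply: le_ereal_sup_tmp; exists (f x) => //; exists x.
Unshelve. all: by end_near. Qed.

Lemma limf_einf_gt_near f a : a < limf_einf f +oo%R ->
  \forall x \near +oo%R, a < f x.
Proof.
rewrite /limf_einf lteNr => /limf_esup_lt_near.
by apply: filterS => x /=; rewrite lteN2.
Qed.

Lemma near_limf_einf_ge f a : (\forall x \near +oo%R, a <= f x) ->
  a <= limf_einf f +oo%R.
Proof.
move=> h; rewrite /limf_einf leeNr; apply: near_limf_esup_le.
by apply: filterS h => x /=; rewrite leeN2.
Qed.

Lemma near_limf_einf_le f a : (\forall x \near +oo%R, f x <= a) ->
  limf_einf f +oo%R <= a.
Proof.
move=> h; rewrite /limf_einf leeNl; apply: near_limf_esup_ge.
by apply: filterS h => x /=; rewrite leeN2.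
Qed.

End LimitsSuperiorInferior.

Section TailRatio.
Context {R : realType}.
Variables (F : R -> \bar R) (G : R -> R).
Hypothesis tailF : forall x, tail F x = (G x)%:E.
Hypothesis G0 : forall x, 0 < G x.
Hypothesis Gni : {homo G : x y /~ x <= y}.

Lemma tail_ratioE y x : tail_ratio F y x = (G (x * y) / G x)%:E.
Proof. by rewrite /tail_ratio !tailF inver gt_eqF. Qed.

(** For [y < 1] the ratio is at least 1 at large [x] because [G] is nonincreasing, so the limit
    being 1 is only an upper bound, and that bound is consistent variation. *)
Lemma limf_esup_tail_ratio_cvgP :
  (limf_esup (tail_ratio F y) +oo%R @[y --> (1:R)^'-] --> 1%E)%E <->
  consistently_varying G.
Proof.
split=> [h r r1|h].
  near=> y.
  have : (limf_esup (tail_ratio F y) +oo%R < r%:E)%E.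
    near: y; apply: (h [set z | (z < r%:E)%E]).
    by apply: open_nbhs_nbhs; split; [exact: open_ereal_lt_ereal|rewrite /= lte_fin].
  move=> /limf_esup_lt_near; apply: filterS => x.
  by rewrite tail_ratioE lte_fin ltr_pdivrMr// => /ltW.
have bnd (e : R) : 0 < e ->
    \forall y \near 1^'-, (1 <= limf_esup (tail_ratio F y) +oo%R <= (1 + e)%:E)%E.
  move=> e0; near=> y.
  have y1 : y < 1 by near: y; exact: nbhs_left_lt.
  apply/andP; split.
    apply: near_limf_esup_ge; near=> x.
    have x0 : 0 < x by near: x; exact: nbhs_pinfty_gt.
    by rewrite tail_ratioE lee_fin ler_pdivlMr// mul1r Gni// ger_pMr// ltW.
  apply: near_limf_esup_le.
  have : \forall x \near +oo, G (x * y) <= (1 + e) * G x.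
    by near: y; apply: h; rewrite ltrDl.
  by apply: filterS => x; rewrite tail_ratioE lee_fin ler_pdivrMr.
apply/fine_cvgP; split.
  have := bnd 1 ltr01; apply: filterS => y /andP[h1 h2].
  rewrite fin_numE; case: limf_esup h1 h2 => //.
apply/cvgrPdist_le => e e0.
have := bnd e e0; apply: filterS => y /= /andP[].
case: limf_esup => //= l; rewrite !lee_fin => l1 l2.
by rewrite ler_distlC; apply/andP; split; lra.
Unshelve. all: by end_near. Qed.

(* The index is a [lim], so its existence has to be shown.  As in Fekete's lemma,
   the limit of [w y = ln (psi y) / ln y] is its supremum over [y > 1]: by
   [powR_tail_bound], [- q < w y0] for one [y0] bounds [psi z] below by a constant
   times [z `^ (- q)] for all [z >= 1]. *)
Lemma upper_Matuszewska_lt (p : R) : consistently_varying G ->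
  (upper_Matuszewska F < p%:E)%E ->
  0 < p /\ exists2 c, 0 < c & \forall a \near +oo, forall (x z : R), a <= x ->
    1 <= z -> G x <= c * z `^ p * G (x * z).
Proof.
move=> hG.
pose psi y := limf_einf (tail_ratio F y) +oo%R.
have psi_near (b : R) y : (b%:E < psi y)%E -> \forall x \near +oo, b * G x <= G (x * y).
  move=> /limf_einf_gt_near; apply: filterS => x.
  by rewrite tail_ratioE lte_fin ltr_pdivlMr// => /ltW.
have near_psi (b : R) y : (\forall x \near +oo, b * G x <= G (x * y)) -> (b%:E <= psi y)%E.
  move=> h; apply: near_limf_einf_ge; apply: filterS h => x.
  by rewrite tail_ratioE lee_fin ler_pdivlMr.
have psi_le1 y : 1 <= y -> (psi y <= 1)%E.
  move=> y1; apply: near_limf_einf_le; near=> x.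
  have x0 : 0 < x by near: x; exact: nbhs_pinfty_gt.
  by rewrite tail_ratioE lee_fin ler_pdivrMr// mul1r Gni// ler_peMr// ltW.
(* Dominated variation with the factor [y^-1] bounds [psi y] below by [C^-1]; with [psi_le1] this
   makes the logarithm finite. *)
have psi_gt0 y : 0 < y -> (0 < psi y)%E.
  move=> y0; have yV0 : 0 < y^-1 by rewrite invr_gt0.
  have [C C0 hC] := consistently_varying_dominated _ _ yV0 Gni hG.
  have : (C^-1%:E <= psi y)%E.
    apply: near_psi.
    have := near_pinfty_mull y (fun x => G (x * y^-1) <= C * G x) y0 hC.
    by apply: filterS => x; rewrite mulfK ?gt_eqF// ler_pdivrMl.
  by apply: lt_le_trans; rewrite lte_fin invr_gt0.
have psi_fin y : 1 <= y -> psi y = (fine (psi y))%:E.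
  move=> y1; rewrite fineK// ge0_fin_numE ?(le_lt_trans (psi_le1 _ y1)) ?ltry//.
  by rewrite ltW// psi_gt0//; lra.
pose f y := fine (psi y).
have f0 y : 1 <= y -> 0 < f y.
  by move=> y1; rewrite -lte_fin -psi_fin// psi_gt0//; lra.
have f1 y : 1 <= y -> f y <= 1.
  by move=> y1; rewrite -lee_fin -psi_fin// psi_le1//; lra.
pose w y := ln (f y) / ln y.
have w0 y : 1 < y -> w y <= 0.
  move=> y1; rewrite /w pmulr_lle0 ?invr_gt0 ?ln_gt0//.
  by rewrite ln_le0// f1// ltW.
have fW y : 1 < y -> ((ln y)^-1%:E * lne (psi y) = (w y)%:E)%E.
  by move=> y1; rewrite psi_fin ?ltW// lne_EFin ?f0 ?ltW// -EFinM mulrC.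
have wbound (y q : R) : 1 < y -> 0 < q -> - q < w y ->
    exists2 c, 0 < c & \forall a \near +oo, forall x z : R, a <= x -> 1 <= z ->
      G x <= c * z `^ q * G (x * z).
  move=> y1 q0 qw; apply: (powR_tail_bound _ _ y) => //.
  apply: psi_near; rewrite psi_fin ?lte_fin ?ltW//.
  rewrite -/(f y) /powR gt_eqF; last by lra.
  by rewrite -(lnK (f0 _ (ltW y1))) ltr_expR -ltr_pdivlMr ?ln_gt0.
pose A := [set w y | y in [set y | 1 < y]].
have A0 : has_sup A.
  split; first by exists (w 2), 2 => //=; rewrite ltr1n.
  by exists 0 => _ [y /= y1 <-]; exact: w0.
have A_ub y : 1 < y -> w y <= sup A by move=> y1; apply: sup_upper_bound => //; exists y.
have sA0 : sup A <= 0 by apply: ge_sup A0.1 _ => _ [y /= y1 <-]; exact: w0.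
have w_cvg : w y @[y --> +oo] --> sup A.
  apply/cvgrPdist_le => e e0.
  have e20 : 0 < e / 2 by rewrite divr_gt0.
  have [_ [y0 /= y01 <-]] := sup_adherent e20 A0.
  (* With this choice [- q] is [sup A - e / 2]. The other [e / 2] absorbs [ln c / ln z] once [z] is
     large. *)
  pose q := e / 2 - sup A => hq.
  have q0 : 0 < q by rewrite /q; lra.
  have qw : - q < w y0 by rewrite /q opprB.
  have [c c0 hc] := wbound y0 q y01 q0 qw.
  near=> z.
  have z1 : 1 < z by near: z; exact: nbhs_pinfty_gt.
  have lz0 : 0 < ln z by rewrite ln_gt0.
  have zq0 : 0 < z `^ q by rewrite powR_gt0//; lra.
  have : ((c^-1 * (z `^ q)^-1)%:E <= psi z)%E.
    apply: near_psi; have [a ha] := filter_ex hc; near=> x.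
    rewrite -invfM ler_pdivrMl ?mulr_gt0//; apply: ha; last exact: ltW.
    by near: x; apply: nbhs_pinfty_ge; rewrite num_real.
  rewrite psi_fin ?(ltW z1)// lee_fin -/(f z) => hf.
  have lnf : - ln c - q * ln z <= ln (f z).
    have -> : - ln c - q * ln z = ln (c^-1 * (z `^ q)^-1).
      by rewrite lnM ?posrE ?invr_gt0// !lnV ?posrE// ln_powR.
    by rewrite ler_ln ?posrE ?(f0 _ (ltW z1))// mulr_gt0// invr_gt0.
  have lc : ln c <= e / 2 * ln z.
    rewrite -ler_pdivrMl// -ler_expR lnK ?posrE; last by lra.
    by near: z; apply: nbhs_pinfty_ge; rewrite num_real.
  rewrite ler_distlC; apply/andP; split; last first.
    by apply: (le_trans (A_ub _ z1)); rewrite lerDl ltW.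
  rewrite /w ler_pdivlMr//; apply: le_trans lnf; rewrite /q; lra.
have cvgW : ((ln y)^-1%:E * lne (psi y))%E @[y --> +oo] --> (sup A)%:E.
  have : (w y)%:E @[y --> +oo] --> (sup A)%:E.
    by apply/fine_cvgP; split=> //; exact: nearW.
  apply: cvg_trans; apply: near_eq_cvg; near=> y.
  have y1 : 1 < y by near: y; exact: nbhs_pinfty_gt.
  by rewrite fW.
rewrite /upper_Matuszewska (cvg_lim _ cvgW)// -EFinN lte_fin => pA.
(* The index is [- sup A], which is nonnegative by [sA0], so any [p] above it is positive. *)
have p0 : 0 < p by lra.
split=> //.
have [_ [y /= y1 <-]] : exists2 v, A v & - p < v.
  by apply: sup_gt A0.1 _; rewrite ltrNl.
by move=> pw; exact: wbound pw.
Unshelve. all: by end_near. Qed.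

End TailRatio.

(** * Tails of random variables *)

(** A real-valued version of the tail, so that the estimates can be carried out in the field [R];
    [tail_cdf] links it to the extended one. *)
Definition survival {d} {T : measurableType d} {R : realType}
  (P : probability T R) (X : T -> R) (x : R) : R := fine (P [set t | x < X t]).

Section Survival.
Context {d : measure_display} {T : measurableType d} {R : realType}.
Variable P : probability T R.
Implicit Types (A B : set T) (X : {mfun T >-> R}).

Lemma measurable_gt_set X x : measurable [set t | x < X t].
Proof.
rewrite (_ : [set _ | _] = X @^-1` `]x, +oo[).
  exact: measurable_funPTI.
by apply/seteqP; split => t /=; rewrite in_itv/= andbT.
Qed.

Lemma probE A : measurable A -> P A = (fine (P A))%:E.
Proof. by move=> mA; rewrite fineK// fin_num_measure. Qed.

Lemma prob_fine_ge0 A : 0 <= fine (P A).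
Proof. by rewrite fine_ge0. Qed.

Lemma le_prob_fine A B : measurable A -> measurable B -> A `<=` B ->
  fine (P A) <= fine (P B).
Proof.
by move=> mA mB AB; rewrite fine_le ?fin_num_measure// le_measure ?inE.
Qed.

Lemma prob_fine_setU_le A B : measurable A -> measurable B ->
  fine (P (A `|` B)) <= fine (P A) + fine (P B).
Proof.
move=> mA mB; have mAB : measurable (A `|` B) by exact: measurableU.
rewrite -lee_fin EFinD -!probE//; exact: measureU2.
Qed.

Lemma prob_fine_bigsetU_le (A : nat -> set T) n :
  (forall i, measurable (A i)) ->
  fine (P (\big[setU/set0]_(i < n) A i)) <= \sum_(i < n) fine (P (A i)).
Proof.
move=> mA; have mU : measurable (\big[setU/set0]_(i < n) A i).
  by apply: bigsetU_measurable => i _.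
rewrite -lee_fin -sumEFin -probE//.
under [X in (_ <= X)%E]eq_bigr do rewrite -probE//.
exact: Boole_inequality.
Qed.

Lemma prob_fine_bigsetU (A : nat -> set T) n :
  (forall i, measurable (A i)) -> trivIset setT A ->
  fine (P (\big[setU/set0]_(i < n) A i)) = \sum_(i < n) fine (P (A i)).
Proof.
move=> mA tA; have mU : measurable (\big[setU/set0]_(i < n) A i).
  by apply: bigsetU_measurable => i _.
apply/EFin_inj; rewrite -sumEFin -probE//.
under [in RHS]eq_bigr do rewrite -probE//.
rewrite (@measure_bigsetU_ord _ _ _ P n xpredT (fun i => A i))//.
move=> i j _ _ h; apply/val_inj; exact: tA h.
Qed.

Lemma survival_ge0 X x : 0 <= survival P X x.
Proof. exact: prob_fine_ge0. Qed.

Lemma survival_le1 X x : survival P X x <= 1.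
Proof.
rewrite -lee_fin /survival -probE ?probability_le1//; exact: measurable_gt_set.
Qed.

Lemma survival_nonincreasing X : {homo survival P X : x y /~ x <= y}.
Proof.
move=> x y xy; apply: le_prob_fine; [exact: measurable_gt_set..|].
by move=> t /=; exact: le_lt_trans.
Qed.

Lemma tail_cdf (X : {RV P >-> R}) x : tail (cdf X) x = (survival P X x)%:E.
Proof.
rewrite /survival -probE; last exact: measurable_gt_set.
rewrite /tail -ccdf_1_cdf /ccdf /distribution /pushforward; congr (P _).
by apply/seteqP; split => t /=; rewrite in_itv/= andbT.
Qed.

Lemma survival_cvg0 (X : {RV P >-> R}) : survival P X x @[x --> +oo] --> 0.
Proof.
apply: (fine_cvg (f := fun x => (survival P X x)%:E)).
have := cvg_ccdfy0 X; apply: cvg_trans; apply: near_eq_cvg; near=> x.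
by rewrite -tail_cdf /tail -ccdf_1_cdf.
Unshelve. all: by end_near. Qed.

Lemma class_C_cdfP (X : {RV P >-> R}) : class_C (cdf X) <->
  (forall x, 0 < survival P X x) /\ consistently_varying (survival P X).
Proof.
have Gni := survival_nonincreasing X.
split=> [[_ X0 hX]|[X0 hX]].
  have G0 x : 0 < survival P X x by rewrite -lte_fin -tail_cdf.
  split=> //; exact/(limf_esup_tail_ratio_cvgP _ _ (tail_cdf X)).
split.
- split; [exact: cdf_nondecreasing|exact: cdf_right_continuous|
    exact: cvg_cdfNy0|exact: cvg_cdfy1].
- by move=> x; rewrite tail_cdf lte_fin.
- exact/(limf_esup_tail_ratio_cvgP _ _ (tail_cdf X)).
Qed.

End Survival.

(** * Product formulas for initial segments and pairs of summands *)

Section MutualIndependence.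
Context {d : measure_display} {T : measurableType d} {R : realType}.
Context {P : probability T R} {xi : nat -> {RV P >-> R}}.
Hypothesis hxi : mutually_independent xi.

Lemma mutually_independent_prefix n (A : nat -> set R) :
  (forall k, measurable (A k)) ->
  fine (P (\bigcap_(k < n) xi k @^-1` A k)) =
  \prod_(k < n) fine (P (xi k @^-1` A k)).
Proof.
move=> mA; have := hxi (seq_fset tt (iota 0 n)) A mA.
have -> : [set` seq_fset tt (iota 0 n)] = `I_n.
  apply/seteqP; split => k; rewrite /mkset;
    by rewrite [k \in _](seq_fsetE tt (iota 0 n) k) mem_iota add0n.
move=> ->; rewrite -[LHS]/(\prod_(k <- seq_fset tt (iota 0 n)) fine (P (xi k @^-1` A k))).
rewrite (perm_big _ (seq_fset_perm tt (iota 0 n))).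
rewrite undup_id ?iota_uniq//.
by rewrite -[X in iota 0 X]subn0 -/(index_iota 0 n) big_mkord.
Qed.

Lemma mutually_independent_pair j k (A B : set R) : j != k ->
  measurable A -> measurable B ->
  fine (P (xi j @^-1` A `&` xi k @^-1` B)) =
  fine (P (xi j @^-1` A)) * fine (P (xi k @^-1` B)).
Proof.
move=> jk mA mB.
pose C i := if i == j then A else B.
have mC i : measurable (C i) by rewrite /C; case: ifP.
have := hxi [fset j; k]%fset C mC.
rewrite (_ : \bigcap_(_ in _) _ = xi j @^-1` A `&` xi k @^-1` B); last first.
  apply/seteqP; split => t /=.
    move=> h; split.
      by have := h j; rewrite /C eqxx; apply; rewrite /= !inE eqxx.
    by have := h k; rewrite /C eq_sym (negPf jk); apply; rewrite /= !inE eqxx orbT.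
  move=> [hA hB] i /=; rewrite !inE => /orP[]/eqP ->; rewrite /C ?eqxx//.
  by rewrite eq_sym (negPf jk).
move=> ->; rewrite /= big_fsetU1 ?inE//= big_seq_fset1 /C eqxx.
by rewrite eq_sym (negPf jk).
Qed.

End MutualIndependence.

(** * Maxima of a fixed number of partial sums *)

Section MaxPartialSum.
Context {d : measure_display} {T : measurableType d} {R : realType}.
Implicit Types (xi : nat -> {mfun T >-> R}).

(** The default value 0 of the big maximum cannot exceed a nonnegative [x], so the excess must come
    from one of the partial sums. *)
Lemma max_partial_sum_gtP xi n t (x : R) : 0 <= x ->
  reflect (exists2 m, (m <= n)%N & x < partial_sum xi m t)
          (x < max_partial_sum xi n t).
Proof.
move=> x0; apply: (iffP (bigmax_gtP _ _ _ _)).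
  move=> [|[m _ hm]]; first by rewrite ltNge x0.
  by exists m => //; rewrite -ltnS.
move=> [m mn hm]; right; exists (Ordinal (mn : (m < n.+1)%N)) => //.
Qed.

HB.instance Definition _ xi n :=
  isMeasurableFun.Build _ _ T R (max_partial_sum xi n)
    (measurable_max_partial_sum xi n).

Context (P : probability T R).

(** If every [xi k] with [k < n] is at most [x / n], then each partial sum of [m <= n] terms is at
    most [m * x / n <= x]; the union bound does the rest. *)
Lemma survival_max_le_sum xi n x : (0 < n)%N -> 0 <= x ->
  survival P (max_partial_sum xi n) x <= \sum_(k < n) survival P (xi k) (x / n%:R).
Proof.
move=> n0 x0; pose E k := [set t | x / n%:R < xi k t].
have mE k : measurable (E k) by exact: measurable_gt_set.
apply: le_trans (prob_fine_bigsetU_le P E n mE).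
apply: le_prob_fine; first exact: measurable_gt_set.
  by apply: bigsetU_measurable.
rewrite -(bigcup_mkord n E) => t /= /(max_partial_sum_gtP _ _ _ _ x0)[m mn xm].
apply: contrapT => h.
move: xm; rewrite ltNge => /negP; apply.
have nR : 0 < n%:R :> R by rewrite ltr0n.
apply: (@le_trans _ _ (\sum_(k < m) (x / n%:R))).
  apply: ler_sum => i _; rewrite leNgt; apply/negP => hi; apply: h; exists i => //=.
  exact: leq_trans (ltn_ord i) mn.
rewrite sumr_const card_ord -[leLHS]mulr_natr mulrAC ler_pdivrMr// ler_wpM2l//.
by rewrite ler_nat.
Qed.

End MaxPartialSum.

(** * Two-sided tail bounds from a single big jump *)

Section IndependentMax.
Context {d : measure_display} {T : measurableType d} {R : realType}.
Context {P : probability T R} {xi : nat -> {RV P >-> R}}.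
Hypothesis hxi : mutually_independent xi.
Let B n x := \sum_(k < n) survival P (xi k) x.

(* If the maximum exceeds [z], then either some summand exceeds [(1 - e) z], or two
   distinct ones exceed [e z / n]. *)
Lemma survival_max_le n (e z : R) : (0 < n)%N -> 0 < e < 1 -> 0 <= z ->
  survival P (max_partial_sum xi n) z <= B n ((1 - e) * z) + B n (e * z / n%:R) ^+ 2.
Proof.
move=> n0 /andP[e0 e1] z0.
pose a := (1 - e) * z; pose b := e * z / n%:R.
have nR : 0 < n%:R :> R by rewrite ltr0n.
have b0 : 0 <= b by rewrite /b divr_ge0 ?mulr_ge0 ?(ltW e0) ?ler0n.
have a0 : 0 <= a by rewrite /a mulr_ge0//; lra.
pose E c k := [set t | c < xi k t].
have mE c k : measurable (E c k) by exact: measurable_gt_set.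
(* The diagonal is emptied so that only distinct indices count and independence applies; the double
   sum is still bounded by the full square [B n b ^+ 2]. *)
pose D k j := if j == k then set0 else E b j `&` E b k.
have mD k j : measurable (D k j) by rewrite /D; case: ifP => // _; exact: measurableI.
pose U k := \big[setU/set0]_(j < n) D k j.
have mU k : measurable (U k) by apply: bigsetU_measurable => j _; exact: mD.
have PD k j : fine (P (D k j)) <= survival P (xi k) b * survival P (xi j) b.
  rewrite /D; case: ifPn => jk; first by rewrite measure0 mulr_ge0// survival_ge0.
  have pre c i : E c i = xi i @^-1` `]c, +oo[.
    by apply/seteqP; split => t /=; rewrite in_itv/= andbT.
  rewrite !pre (mutually_independent_pair hxi)// -!pre mulrC.
  exact: lexx.
have PU k : fine (P (U k)) <= survival P (xi k) b * B n b.
  apply: (le_trans (prob_fine_bigsetU_le _ _ _ _)) => //.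
  by rewrite /B big_distrr/=; apply: ler_sum => j _; exact: PD.
have PUU : fine (P (\big[setU/set0]_(k < n) U k)) <= B n b ^+ 2.
  apply: (le_trans (prob_fine_bigsetU_le _ _ _ mU)).
  by rewrite expr2 {1}/B big_distrl/=; apply: ler_sum => k _; exact: PU.
apply: le_trans (lerD (prob_fine_bigsetU_le P (E a) n (mE a)) PUU).
have mUE : measurable (\big[setU/set0]_(i < n) E a i) by apply: bigsetU_measurable.
have mUU : measurable (\big[setU/set0]_(i < n) U i) by apply: bigsetU_measurable.
apply: le_trans (prob_fine_setU_le _ _ _ mUE mUU).
apply: le_prob_fine; [exact: measurable_gt_set|exact: measurableU|].
rewrite -(bigcup_mkord n (E a)) -(bigcup_mkord n U) => t /=.
move=> /(max_partial_sum_gtP _ _ _ _ z0)[m mn zm].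
apply: contrapT => h.
have ha k : (k < n)%N -> xi k t <= a.
  move=> kn; rewrite leNgt; apply/negP => hk; apply: h; left.
  by exists k.
have hb k j : (k < n)%N -> (j < n)%N -> j != k -> b < xi k t -> xi j t <= b.
  move=> kn jn jk hk; rewrite leNgt; apply/negP => hj; apply: h; right.
  exists k => //; rewrite /U -(bigcup_mkord n (D k)); exists j => //.
  by rewrite /D (negPf jk).
move: zm; rewrite ltNge => /negP; apply.
have znb : z = a + n%:R * b by rewrite /a /b; field; exact: lt0r_neq0.
(* Positive parts let the sum be extended from [m] to [n] terms, so one estimate covers all partial
   sums. *)
have le_pos : partial_sum xi m t <= \sum_(k < n) Num.max 0 (xi k t).
  rewrite /partial_sum (big_ord_widen n (fun k => xi k t) mn) big_mkcond/=.
  by apply: ler_sum => k _; case: ifP => _; rewrite le_max lexx ?orbT.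
apply: (le_trans le_pos).
have sum_b (I : pred 'I_n) : (forall k : 'I_n, I k -> xi k t <= b) ->
    \sum_(k < n | I k) Num.max 0 (xi k t) <= n%:R * b.
  move=> hI; apply: (@le_trans _ _ (\sum_(k < n) b)).
    rewrite big_mkcond/=; apply: ler_sum => k _; case: ifPn => // Ik.
    by rewrite ge_max b0 hI.
  by rewrite sumr_const card_ord mulr_natl.
(* If some summand exceeds [b], it is at most [a] and all the others are at most [b], for a total of
   at most [a + n * b = z]. Otherwise all are at most [b]. *)
have [[k hk]|nk] := pselect (exists k : 'I_n, b < xi k t).
  rewrite (bigD1 k)//= znb lerD//; first by rewrite ge_max a0 ha.
  by apply: sum_b => j jk; exact: hb hk.
apply: (@le_trans _ _ (n%:R * b)); last by rewrite znb lerDr.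
apply: sum_b => k _; rewrite leNgt; apply/negP => hk; apply: nk; by exists k.
Qed.

(* The events "xi k is the first summand above (1 + e) x and all earlier ones
   exceed - e x / n" are disjoint and force [x < partial_sum xi k.+1]. *)
Lemma survival_max_ge n (e x : R) : (0 < n)%N -> 0 < e -> 0 <= x ->
  \sum_(k < n) survival P (xi k) ((1 + e) * x) *
    \prod_(j < k) fine (P (xi j @^-1` `](- (e * x / n%:R)), ((1 + e) * x)])) <=
  survival P (max_partial_sum xi n) x.
Proof.
move=> n0 e0 x0.
pose u := (1 + e) * x; pose v := - (e * x / n%:R).
pose A (k j : nat) := if j == k then `]u, +oo[%classic else `]v, u]%classic.
have mA k j : measurable (A k j) by rewrite /A; case: ifP.
pose D k := \bigcap_(j < k.+1) xi j @^-1` A k j.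
have mD k : measurable (D k).
  by apply: bigcap_measurable => [|j _]; [exists 0%N|exact: measurable_funPTI].
have PD k : fine (P (D k)) = survival P (xi k) u *
    \prod_(j < k) fine (P (xi j @^-1` `]v, u])).
  rewrite (mutually_independent_prefix hxi)// big_ord_recr/= mulrC; congr (_ * _).
    rewrite /A eqxx /survival; congr (fine (P _)).
    by apply/seteqP; split => t /=; rewrite in_itv/= andbT.
  by apply: eq_bigr => j _; rewrite /A ltn_eqF.
rewrite -/u -/v; under eq_bigr do rewrite -PD.
(* For [k < l], the event [D k] puts [xi k] above [u] whereas [D l] keeps it at most [u]. *)
have tD : trivIset setT D.
  have aux k l t : (k < l)%N -> D k t -> D l t -> False.
    move=> kl /(_ k (ltnSn k)) + /(_ k (ltnW kl : (k < l.+1)%N)).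
    rewrite /A eqxx ltn_eqF//= !in_itv/= andbT => h /andP[_].
    by rewrite leNgt h.
  move=> k l _ _ [t [Dk Dl]].
  by case: (ltngtP k l) => // kl; exfalso; [exact: aux kl Dk Dl|exact: aux kl Dl Dk].
rewrite -prob_fine_bigsetU//.
apply: le_prob_fine; [exact: bigsetU_measurable|exact: measurable_gt_set|].
rewrite -(bigcup_mkord n D) => t [k /= kn Dk].
apply/(max_partial_sum_gtP _ _ _ _ x0); exists k.+1 => //.
rewrite /partial_sum big_ord_recr/=.
have nR : 0 < n%:R :> R by rewrite ltr0n.
have uk : u < xi k t by have := Dk k (ltnSn k); rewrite /A eqxx /= in_itv/= andbT.
(* The [k <= n] earlier summands lose at most [e * x] together, and the jump exceeds
   [(1 + e) * x]. *)
have vk : - (e * x) <= \sum_(j < k) xi j t.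
  apply: (@le_trans _ _ (\sum_(j < k) v)).
    rewrite sumr_const card_ord -[leRHS]mulr_natr /v mulNr lerN2.
    rewrite mulrAC ler_pdivrMr// ler_wpM2l//; last by rewrite ler_nat ltnW.
    by rewrite mulr_ge0// ltW.
  apply: ler_sum => j _.
  have := Dk j (ltnW (ltn_ord j : (j < k)%N)); rewrite /A ltn_eqF//= in_itv/=.
  by move=> /andP[/ltW].
have -> : x = - (e * x) + u by rewrite /u; ring.
exact: ler_ltD.
Qed.

End IndependentMax.

Section IntervalProbability.
Context {d : measure_display} {T : measurableType d} {R : realType}.
Context {P : probability T R}.

Lemma survival_cvg1 (X : {RV P >-> R}) : survival P X x @[x --> -oo] --> (1:R).
Proof.
apply: (fine_cvg (f := fun x => (survival P X x)%:E)).
have := cvg_ccdfNy1 X; apply: cvg_trans; apply: near_eq_cvg; near=> x.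
by rewrite -tail_cdf /tail -ccdf_1_cdf.
Unshelve. all: by end_near. Qed.

(** The probability lies between [survival P X (v x) - survival P X (u x)], which tends to 1, and
    1. *)
Lemma prob_itv_cvg1 (X : {RV P >-> R}) (u v : R -> R) :
  u x @[x --> +oo] --> +oo -> v x @[x --> +oo] --> -oo ->
  fine (P (X @^-1` `]v x, u x])) @[x --> +oo] --> (1:R).
Proof.
move=> uy vNy.
have mI x : measurable (X @^-1` `]v x, u x]) by exact: measurable_funPTI.
have lim1 : survival P X (v x) - survival P X (u x) @[x --> +oo] --> (1:R).
  rewrite -[X in _ --> X]subr0; apply: cvgB.
    exact: cvg_comp vNy (survival_cvg1 X).
  exact: cvg_comp uy (survival_cvg0 P X).
apply: (squeeze_cvgr _ lim1 (cvg_cst (1:R))).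
near=> x; apply/andP; split; last first.
  by rewrite -lee_fin -probE// probability_le1.
rewrite lerBlDr; apply: le_trans (prob_fine_setU_le _ _ _ (mI x) (measurable_gt_set X _)).
apply: le_prob_fine; [exact: measurable_gt_set|
  exact: measurableU (mI x) (measurable_gt_set X _)|].
move=> t /= vX; rewrite in_itv/= vX/=.
by case: (leP (X t) (u x)) => h; [left|right].
Unshelve. all: by end_near. Qed.

End IntervalProbability.

(** * Asymptotics for fixed n and a bound uniform in n *)

Section MaxTail.
Context {d : measure_display} {T : measurableType d} {R : realType}.
Context {P : probability T R} {xi : nat -> {RV P >-> R}}.
Hypothesis hxi : mutually_independent xi.
Hypothesis G0 : forall k x, 0 < survival P (xi k) x.
Hypothesis hG : forall k, consistently_varying (survival P (xi k)).
Let B n x := \sum_(k < n) survival P (xi k) x.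

(** In [survival_max_le] with [e = 1 - y], consistent variation bounds the linear term by
    [s * B n x]. In the square, one factor is at most [C * B n x] by dominated variation and the
    other tends to 0, so the square fits into the remaining [(r - s) * B n x]. *)
Lemma max_partial_sum_le_near n r : (0 < n)%N -> 1 < r ->
  \forall x \near +oo, survival P (max_partial_sum xi n) x <= r * B n x.
Proof.
move=> n0 r1.
have hB : consistently_varying (B n).
  exact: (consistently_varying_sum (fun k => survival P (xi k))).
have Bni : {homo B n : x y /~ x <= y}.
  by move=> x y xy; apply: ler_sum => k _; exact: (survival_nonincreasing P (xi k) _ _ xy).
have B0 x : 0 <= B n x by apply: sumr_ge0 => k _; exact: survival_ge0.
have Bcvg : B n x @[x --> +oo] --> (0:R).
  rewrite /B; elim: {n0 hB Bni B0} n => [|m IH].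
    by under eq_fun do rewrite big_ord0; exact: cvg_cst.
  under eq_fun do rewrite big_ord_recr/=.
  have := cvgD IH (survival_cvg0 P (xi m)); rewrite addr0; exact.
pose s := (1 + r) / 2.
have s1 : 1 < s by rewrite /s; lra.
have [y [/andP[y0 y1] hy]] : exists y, 0 < y < 1 /\
    \forall x \near +oo, B n (x * y) <= s * B n x.
  apply/(filter_ex (F := (1:R)^'-)); near=> y; split; last by near: y; exact: hB.
  by apply/andP; split; near: y; [exact: nbhs_left_gt|exact: nbhs_left_lt].
have nR : 0 < n%:R :> R by rewrite ltr0n.
pose a := (1 - y) / n%:R.
have a0 : 0 < a by rewrite divr_gt0//; lra.
have [C C0 hC] := consistently_varying_dominated _ _ a0 Bni hB.
have eps0 : 0 < (r - s) / C by rewrite divr_gt0// /s; lra.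
near=> x.
have x0 : 0 < x by near: x; exact: nbhs_pinfty_gt.
have e01 : 0 < 1 - y < 1 by apply/andP; split; lra.
apply: (le_trans (survival_max_le hxi n _ _ n0 e01 (ltW x0))).
rewrite -/(B n ((1 - (1 - y)) * x)) -/(B n ((1 - y) * x / n%:R)).
have -> : (1 - (1 - y)) * x = x * y by ring.
have -> : (1 - y) * x / n%:R = x * a by rewrite /a; ring.
have h1 : B n (x * y) <= s * B n x by near: x.
have h2 : B n (x * a) <= C * B n x by near: x.
have h3 : B n (x * a) <= (r - s) / C.
  near: x; apply: (@near_pinfty_mull _ a (fun x => B n x <= (r - s) / C)) => //.
  exact: cvgr_le Bcvg _ eps0.
have h4 : B n (x * a) ^+ 2 <= (r - s) * B n x.
  have -> : (r - s) * B n x = (r - s) / C * (C * B n x) by field; exact: lt0r_neq0.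
  by rewrite expr2 ler_pM.
have -> : r * B n x = s * B n x + (r - s) * B n x by ring.
exact: lerD.
Unshelve. all: by end_near. Qed.

(** In [survival_max_ge] with [1 + e = y^-1], consistent variation at [x / y] costs one factor [s].
    The products tend to 1, hence eventually exceed [s^-1] and cost the other, with [r = s * s]. *)
Lemma max_partial_sum_ge_near n r : (0 < n)%N -> 1 < r ->
  \forall x \near +oo, B n x <= r * survival P (max_partial_sum xi n) x.
Proof.
move=> n0 r1.
have hB : consistently_varying (B n).
  exact: (consistently_varying_sum (fun k => survival P (xi k))).
pose s := Num.sqrt r.
have s1 : 1 < s by rewrite /s -sqrtr1 ltr_sqrt //; lra.
have s0 : 0 < s by lra.
have ss : r = s * s by rewrite -expr2 sqr_sqrtr//; lra.
have [y [/andP[y0 y1] hy]] : exists y, 0 < y < 1 /\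
    \forall x \near +oo, B n (x * y) <= s * B n x.
  apply/(filter_ex (F := (1:R)^'-)); near=> y; split; last by near: y; exact: hB.
  by apply/andP; split; near: y; [exact: nbhs_left_gt|exact: nbhs_left_lt].
have nR : 0 < n%:R :> R by rewrite ltr0n.
pose e := y^-1 - 1.
have e0 : 0 < e by rewrite /e subr_gt0 invf_gt1.
have yV0 : 0 < y^-1 by rewrite invr_gt0.
have hprod k : \forall x \near +oo, s^-1 <=
    \prod_(j < k) fine (P (xi j @^-1` `](- (e * x / n%:R)), ((1 + e) * x)])).
  have : \prod_(j < k) fine (P (xi j @^-1` `](- (e * x / n%:R)), ((1 + e) * x)]))
      @[x --> +oo] --> (1:R).
    elim: k => [|k IH].
      by under eq_fun do rewrite big_ord0; exact: cvg_cst.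
    under eq_fun do rewrite big_ord_recr/=.
    have qk : fine (P (xi k @^-1` `](- (e * x / n%:R)), ((1 + e) * x)]))
        @[x --> +oo] --> (1:R).
      apply: prob_itv_cvg1.
        by apply: gt0_cvgMry; [lra|exact: cvg_id].
      apply: (iffRL (cvgNrNy (fun x : R => e * x / n%:R))).
      apply: gt0_cvgMly; first by rewrite invr_gt0.
      by apply: gt0_cvgMry => //; exact: cvg_id.
    have := cvgM IH qk; rewrite mulr1; exact.
  by move/cvgr_ge; apply; rewrite invf_lt1.
near=> x.
have x0 : 0 < x by near: x; exact: nbhs_pinfty_gt.
have h1 : B n x <= s * B n ((1 + e) * x).
  have -> : (1 + e) * x = x * y^-1 by rewrite /e; ring.
  have -> : B n x = B n (x * y^-1 * y) by rewrite divfK ?gt_eqF.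
  by near: x; exact: (near_pinfty_mull y^-1 (fun x => B n (x * y) <= s * B n x)).
apply: (le_trans h1); rewrite ss -mulrA ler_pM2l// -ler_pdivrMl//.
apply: le_trans (survival_max_ge hxi n _ _ n0 e0 (ltW x0)).
rewrite /B big_distrr/=; apply: ler_sum => k _.
rewrite mulrC ler_wpM2l ?survival_ge0//.
(* There are finitely many [k], so a common threshold for [x] exists. *)
move: k; near: x; apply: filter_forall => k; exact: hprod.
Unshelve. all: by end_near. Qed.

Lemma consistently_varying_max_partial_sum n :
  consistently_varying (survival P (max_partial_sum xi n)).
Proof.
(* For [n = 0] the maximum is identically 0, and its tail vanishes on the nonnegative half-line. *)
have [->|n0] := posnP n.
  apply: near_eq_consistently_varying consistently_varying0; near=> x.
  rewrite /survival (_ : [set _ | _] = set0) ?measure0//.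
  rewrite -subset0 => t /=; apply/negP; rewrite -leNgt.
  rewrite /max_partial_sum big_ord_recl /partial_sum !big_ord0 maxxx.
  by near: x; apply: nbhs_pinfty_ge; rewrite num_real.
apply: (asymp_equiv_consistently_varying (B n)).
- by move=> r; exact: max_partial_sum_le_near.
- by move=> r; exact: max_partial_sum_ge_near.
- exact: (consistently_varying_sum (fun k => survival P (xi k))).
Unshelve. all: by end_near. Qed.

(** The threshold for [x] must not depend on [n], although [x / n] may be small. If [x / n >= a],
    the union bound, the averaged tail bound and the power bound with [z = n] apply. If [x < n * a],
    the trivial bound 1 suffices, since [G a <= c * n]^ p * G (a * n) <= c * n [^ p * G x]. *)
Lemma max_partial_sum_uniform_bound (p c M : R) : 0 < p -> 0 < c ->
  (\forall a \near +oo, forall x z : R, a <= x -> 1 <= z ->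
    survival P (xi 0%N) x <= c * z `^ p * survival P (xi 0%N) (x * z)) ->
  (\forall x \near +oo, forall n, (0 < n)%N ->
    B n x <= M * n%:R * survival P (xi 0%N) x) ->
  exists2 C, 0 < C & \forall x \near +oo, forall n, (0 < n)%N ->
    survival P (max_partial_sum xi n) x <=
      C * n%:R `^ (p + 1) * survival P (xi 0%N) x.
Proof.
move=> p0 c0 hc hM; set G := survival P (xi 0%N).
have [a [a0 [ha hMa]]] : exists a, 0 < a /\
   ((forall x z : R, a <= x -> 1 <= z -> G x <= c * z `^ p * G (x * z)) /\
   (forall x, a <= x -> forall n, (0 < n)%N -> B n x <= M * n%:R * G x)).
  apply/(filter_ex (F := +oo)); near=> a; split; [|split].
  - by near: a; exact: nbhs_pinfty_gt.
  - by near: a.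
  - by near: a; exact: near_pinfty_ge.
have M0 : 0 <= M.
  have := hMa a (lexx a) 1%N isT; rewrite mulr1 /B big_ord1 => h.
  have := G0 0%N a; rewrite -/G in h *; nra.
(* One summand for each of the two ranges of [x / n]. *)
exists (M * c + c / G a).
  by rewrite ltr_wpDl ?mulr_ge0 ?divr_gt0// ?G0// ltW.
near=> x => n n0.
have ax : a <= x by near: x; apply: nbhs_pinfty_ge; rewrite num_real.
have x0 : 0 < x by lra.
have n1 : 1 <= n%:R :> R by rewrite ler1n.
have nR : 0 < n%:R :> R by lra.
have np0 : 0 < n%:R `^ p :> R by rewrite powR_gt0.
have np : n%:R `^ (p + 1) = n%:R * n%:R `^ p :> R.
  by rewrite powRD ?powRr1 1?mulrC// ?ltW//; apply/implyP => _; rewrite gt_eqF.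
have Gx := G0 0%N x; have Ga := G0 0%N a; rewrite -/G in Gx Ga.
have K1 : 0 <= c / G a * (n%:R * n%:R `^ p) * G x.
  by rewrite !mulr_ge0 ?invr_ge0// ltW.
have K2 : 0 <= M * c * (n%:R * n%:R `^ p) * G x.
  by rewrite !mulr_ge0 ?invr_ge0// ltW.
rewrite np !mulrDl.
have [xn|xn] := leP a (x / n%:R).
  apply: (le_trans (survival_max_le_sum P xi n x n0 (ltW x0))).
  apply: (le_trans (hMa _ xn n n0)).
  apply: (@le_trans _ _ (M * c * (n%:R * n%:R `^ p) * G x)); last by rewrite lerDl.
  have -> : M * c * (n%:R * n%:R `^ p) * G x = M * n%:R * (c * n%:R `^ p * G x) by ring.
  rewrite ler_wpM2l ?mulr_ge0 ?ler0n//.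
  by have := ha _ _ xn n1; rewrite divfK ?gt_eqF.
apply: (le_trans (survival_le1 _ _ _)).
apply: (@le_trans _ _ (c / G a * (n%:R * n%:R `^ p) * G x)); last by rewrite lerDr.
have -> : c / G a * (n%:R * n%:R `^ p) * G x = (c * n%:R `^ p * G x) * n%:R / G a by ring.
rewrite ler_pdivlMr// mul1r.
have hGa : G a <= c * n%:R `^ p * G x.
  apply: (le_trans (ha a n%:R (lexx a) n1)).
  rewrite ler_pM2l ?mulr_gt0//; apply: survival_nonincreasing.
  by rewrite ltW// -ltr_pdivrMr.
by apply: (le_trans hGa); rewrite ler_peMr// ltW// !mulr_gt0.
Unshelve. all: by end_near. Qed.

End MaxTail.

(** * Random stopping *)

Section RandomStopping.
Context {d : measure_display} {T : measurableType d} {R : realType}.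
Context {P : probability T R} {xi : nat -> {RV P >-> R}} {eta : {RV P >-> nat}}.
Hypothesis hind : independent_of_sequence eta xi.

Let mass n : R := fine (P (eta @^-1` [set n])).
Let H n := survival P (max_partial_sum xi n).

Let measurable_eta (B : set nat) : measurable (eta @^-1` B).
Proof. exact: measurable_funPTI. Qed.

Lemma sigma_sequence_max_gt n x :
  sigma_sequence xi [set t | x < max_partial_sum xi n t].
Proof.
(* The partial sums, read on T with the sigma-algebra generated by xi. *)
pose S := \bigcup_k preimage_set_system setT (xi k) (@measurable _ R).
pose T' := g_sigma_algebraType S.
have mxi k : measurable_fun [set: T'] (xi k : T' -> R).
  move=> _ B mB; rewrite setTI; apply: sub_gen_smallest.
  by exists k => //; exists B => //; rewrite setTI.
pose xi' k : {mfun T' >-> R} :=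
  HB.pack (xi k : T' -> R) (isMeasurableFun.Build _ _ T' R _ (mxi k)).
exact: (measurable_gt_set (max_partial_sum xi' n) x).
Qed.

Lemma stopped_at n x :
  P (eta @^-1` [set n] `&` [set t | x < max_partial_sum xi n t]) =
  (mass n * H n x)%:E.
Proof.
rewrite hind//; last exact: sigma_sequence_max_gt.
by rewrite EFinM -!probE//; exact: measurable_gt_set.
Qed.

Let E x n := eta @^-1` [set n] `&` [set t | x < max_partial_sum xi n t].

Let mE x n : measurable (E x n).
Proof. by apply: measurableI => //; exact: measurable_gt_set. Qed.

Lemma survival_stopped_max_series x :
  P [set t | x < stopped_max_fun xi eta t] = (\sum_(n <oo) (mass n * H n x)%:E)%E.
Proof.
rewrite (_ : [set _ | _] = \bigcup_n E x n).
  rewrite measure_semi_bigcup//.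
  - by apply: eq_eseriesr => n _; exact: stopped_at.
  - by move=> i j _ _ [t [[/= <- _] [/= <- _]]].
  - exact: bigcup_measurable.
apply/seteqP; split => [t xt|t [n _ [/= <- //]]].
by exists (eta t).
Qed.

Let mH_ge0 n x : 0 <= mass n * H n x.
Proof. by rewrite mulr_ge0 ?prob_fine_ge0. Qed.

Lemma mixture_le_survival_stopped_max K x :
  \sum_(n < K) mass n * H n x <= survival P (stopped_max_fun xi eta) x.
Proof.
rewrite -lee_fin -sumEFin /survival -probE; last exact: measurable_gt_set.
rewrite survival_stopped_max_series -(big_mkord xpredT (fun n => (mass n * H n x)%:E)).
by apply: nneseries_lim_ge => n _ _; rewrite lee_fin.
Qed.

(** The moment becomes a series with the same weights [mass n] as the tail of the stopped maximum,
    so the two can be compared term by term. *)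
Lemma expectation_powR_series (p : R) :
  ('E_P[fun t => ((eta t)%:R `^ p)%R] = \sum_(n <oo) (mass n * n%:R `^ p)%:E)%E.
Proof.
rewrite unlock (_ : [set: T] = \bigcup_n eta @^-1` [set n]); last first.
  by apply/seteqP; split => t // _; exists (eta t).
rewrite ge0_integral_bigcup//; last first.
- by move=> i j _ _ [t [/= <- <-]].
- move=> mD B mB; apply: measurableI => //.
  exact: (measurable_eta ((fun n : nat => (n%:R `^ p)%:E) @^-1` B)).
apply: eq_eseriesr => n _.
rewrite (eq_integral (cst (n%:R `^ p)%:E)); last by move=> t; rewrite inE/= => ->.
by rewrite integral_cst// EFinM -probE// muleC.
Qed.

(** The terms with [n >= K] are dominated by [C * survival P (xi 0%N) x] times the remainder of the
    convergent moment series. [K] is chosen to make that remainder less than [eps / C],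
    independently of [x]. *)
Lemma survival_stopped_max_le_mixture (p C eps : R) : 0 < C ->
  ('E_P[fun t : T => ((eta t)%:R `^ p)%R] < +oo)%E -> 
  (\forall x \near +oo, forall n, (0 < n)%N ->
     H n x <= C * n%:R `^ p * survival P (xi 0%N) x) -> 0 < eps ->
  exists K, \forall x \near +oo, survival P (stopped_max_fun xi eta) x <=
    \sum_(n < K) mass n * H n x + eps * survival P (xi 0%N) x.
Proof.
move=> C0; rewrite expectation_powR_series => Efin hH eps0.
have mass_ge0 n : 0 <= mass n by exact: prob_fine_ge0.
have ep0 n : (0 <= (mass n * n%:R `^ p)%:E)%E.
  by rewrite lee_fin mulr_ge0 ?powR_ge0.
have eC : 0 < eps / C by rewrite divr_gt0.
(* Positivity of [K] guarantees [0 < n] for every remaining term, as the bound on [H n] requires. *)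
have [K K0 hK] : exists2 K, (0 < K)%N &
    (\sum_(K <= n <oo) (mass n * n%:R `^ p)%:E < (eps / C)%:E)%E.
  have tl := nneseries_tail_cvg Efin (fun n _ => ep0 n).
  have /(filter_ex (F := \oo))[K [K0 hK]] : \forall K \near \oo, (0 < K)%N /\
      (\sum_(K <= n <oo) (mass n * n%:R `^ p)%:E < (eps / C)%:E)%E.
    near=> K; split; first by near: K; exact: nbhs_infty_gt.
    near: K; apply: (tl [set z | (z < (eps / C)%:E)%E]).
    by apply: open_nbhs_nbhs; split; [exact: open_ereal_lt_ereal|rewrite /= lte_fin].
  by exists K.
exists K; near=> x.
have hx n : (0 < n)%N -> H n x <= C * n%:R `^ p * survival P (xi 0%N) x.
  by move: n; near: x.
set G := survival P (xi 0%N) x in hx *.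
have G0 : 0 <= G by exact: survival_ge0.
rewrite -lee_fin EFinD -sumEFin /survival -probE; last exact: measurable_gt_set.
rewrite survival_stopped_max_series (nneseries_split 0 K)//; last first.
  by move=> n _; rewrite lee_fin.
rewrite add0n big_mkord leeD2l//.
apply: (@le_trans _ _ (\sum_(K <= n <oo) ((C * G)%:E * (mass n * n%:R `^ p)%:E))%E).
  rewrite eseries_cond [leRHS]eseries_cond.
  apply: lee_nneseries => [n _ _|n /= Kn]; first by rewrite lee_fin.
  rewrite -EFinM lee_fin.
  have -> : C * G * (mass n * n%:R `^ p) = mass n * (C * n%:R `^ p * G) by ring.
  rewrite ler_wpM2l ?mass_ge0//; apply: hx; exact: leq_trans K0 Kn.
rewrite nneseriesZl//.
have -> : (eps * G)%:E = ((C * G)%:E * (eps / C)%:E)%E.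
  by rewrite -EFinM; congr (_%:E); field; exact: lt0r_neq0.
by apply: lee_wpmul2l; [rewrite lee_fin mulr_ge0// ltW|exact: ltW].
Unshelve. all: by end_near. Qed.

(** On the event that [eta] is nonzero, the maximum includes [partial_sum xi 1], which is [xi 0].
    This converts an error measured against the tail of [xi 0] into a relative one. *)
Lemma survival_stopped_max_ge x :
  fine (P (eta @^-1` [set~ 0%N])) * survival P (xi 0%N) x <=
  survival P (stopped_max_fun xi eta) x.
Proof.
have mx0 : measurable [set t | x < xi 0%N t] by exact: measurable_gt_set.
have -> : fine (P (eta @^-1` [set~ 0%N])) * survival P (xi 0%N) x =
    fine (P (eta @^-1` [set~ 0%N] `&` [set t | x < xi 0%N t])).
  apply/EFin_inj; rewrite -probE; last exact: measurableI.
  rewrite hind//; first by rewrite EFinM -!probE.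
  apply: sub_gen_smallest; exists 0%N => //; exists `]x, +oo[%classic => //.
  by rewrite setTI; apply/seteqP; split => t /=; rewrite in_itv/= andbT.
apply: le_prob_fine; [exact: measurableI|exact: measurable_gt_set|].
move=> t [/= eta0 xt]; rewrite /stopped_max_fun /max_partial_sum.
apply: (lt_le_trans xt).
have h : (1 < (eta t).+1)%N by rewrite ltnS lt0n; exact/eqP.
have -> : xi 0%N t = partial_sum xi (Ordinal h) t.
  by rewrite /partial_sum big_ord_recl big_ord0 addr0.
exact: le_bigmax.
Qed.

End RandomStopping.

(** * Closure of class C under random stopping *)

Theorem theorem5 (d : measure_display) (T : measurableType d) (R : realType)
    (P : probability T R) (xi : nat -> {RV P >-> R}) (eta : {RV P >-> nat})
    (hxi : mutually_independent xi)
    (heta : counting_rv eta)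
    (hind : independent_of_sequence eta xi)
    (ha : forall k : nat, class_C (cdf (xi k)))
    (hb : (limf_esup
             (fun x : R =>
                ereal_sup
                  [set ((n%:R%:E * tail (cdf (xi 0%N)) x)^-1 *
                        \sum_(k < n) tail (cdf (xi k)) x)%E
                  | n in [set n : nat | (1 <= n)%N]])
             +oo%R < +oo)%E)
    (hc : exists p : R,
            (upper_Matuszewska (cdf (xi 0%N)) < p%:E)%E /\
            ('E_P[fun t : T => ((eta t)%:R `^ (p + 1))%R] < +oo)%E) :
  class_C (cdf (stopped_max xi eta)).
Proof.
have G0 k x : 0 < survival P (xi k) x by exact: ((class_C_cdfP _ _).1 (ha k)).1.
have hG k : consistently_varying (survival P (xi k)).
  exact: ((class_C_cdfP _ _).1 (ha k)).2.
have [M hM] : exists M : R, \forall x \near +oo, forall n, (0 < n)%N ->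
    \sum_(k < n) survival P (xi k) x <= M * n%:R * survival P (xi 0%N) x.
  set f := (f in limf_esup f _) in hb.
  have [M hM] : exists M : R, (limf_esup f +oo%R < M%:E)%E.
    move: hb; case: limf_esup => [r| |] // _; last by exists 0; exact: ltNyr.
    by exists (r + 1); rewrite lte_fin ltrDl.
  (* The supremum over [n] sits inside the upper limit, so the threshold for [x] is the same for all
     [n]. *)
  exists M; move/limf_esup_lt_near: hM; apply: filterS => x fx n n0.
  have nR : 0 < n%:R :> R by rewrite ltr0n.
  have : ((n%:R%:E * tail (cdf (xi 0%N)) x)^-1 *
      \sum_(k < n) tail (cdf (xi k)) x <= M%:E)%E.
    by apply: le_trans (ltW fx); apply: ereal_sup_ubound; exists n.
  under eq_bigr do rewrite tail_cdf.
  rewrite tail_cdf -EFinM inver gt_eqF ?mulr_gt0// sumEFin -EFinM lee_fin.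
  by rewrite ler_pdivrMl ?mulr_gt0// mulrC mulrA.
have [p [hJ Ep]] := hc.
have [p0 [c c0 hpc]] := upper_Matuszewska_lt _ _ (tail_cdf P (xi 0%N)) (G0 0%N)
  (survival_nonincreasing P (xi 0%N)) p (hG 0%N) hJ.
have [C C0 hC] := max_partial_sum_uniform_bound G0 p c M p0 c0 hpc hM.
set q := fine (P (eta @^-1` [set~ 0%N])).
(* This is the nondegeneracy of [eta] at zero. *)
have q0 : 0 < q.
  rewrite -lte_fin -probE; last exact: measurable_funPTI.
  rewrite -preimage_setC probability_setC; last exact: measurable_funPTI.
  by rewrite sube_gt0.
have Hge := @survival_stopped_max_ge _ _ _ _ _ _ hind.
apply/class_C_cdfP; split=> [x|].
  by apply: lt_le_trans (Hge x); rewrite mulr_gt0.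
move=> r r1.
(* The allowance [r] is split into [s] for the finite mixture and [r - s] for the remainder. In
   [eps], the 2 offsets the loss in [yG] and [q] the constant in [Hge], so that
   [eps * 2 = (r - s) * q]. *)
pose s := (1 + r) / 2.
have s1 : 1 < s by rewrite /s; lra.
pose eps := (r - s) * q / 2.
have eps0 : 0 < eps by rewrite /eps !mulr_gt0// /s; lra.
have [K hK] := survival_stopped_max_le_mixture hind (p + 1) C eps C0 Ep hC eps0.
pose A x := \sum_(n < K) fine (P (eta @^-1` [set (n : nat)])) *
  survival P (max_partial_sum xi n) x.
have Kge x : A x <= survival P (stopped_max xi eta) x.
  exact: (mixture_le_survival_stopped_max hind).
have hA : consistently_varying A.
  apply: (consistently_varying_sum (fun n x =>
    fine (P (eta @^-1` [set n])) * survival P (max_partial_sum xi n) x)) => n.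
  apply: consistently_varyingZ; first exact: prob_fine_ge0.
  exact: consistently_varying_max_partial_sum.
near=> y.
have y0 : 0 < y by near: y; exact: nbhs_left_gt.
have yA : \forall x \near +oo, A (x * y) <= s * A x by near: y; exact: hA.
have yG : \forall x \near +oo, survival P (xi 0%N) (x * y) <= 2 * survival P (xi 0%N) x.
  by near: y; apply: hG; lra.
have h1 := near_pinfty_mull y _ y0 hK.
near=> x.
have h2 : survival P (stopped_max xi eta) (x * y) <=
    A (x * y) + eps * survival P (xi 0%N) (x * y) by near: x.
have h3 : A (x * y) <= s * A x by near: x.
have h4 : survival P (xi 0%N) (x * y) <= 2 * survival P (xi 0%N) x by near: x.
have h5 := Kge x; have h6 := Hge x.
apply: (le_trans h2).
have h7 : s * A x <= s * survival P (stopped_max xi eta) x by rewrite ler_pM2l//; lra.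
have h8 : eps * survival P (xi 0%N) (x * y) <= (r - s) * survival P (stopped_max xi eta) x.
  apply: (@le_trans _ _ (eps * (2 * survival P (xi 0%N) x))); first by rewrite ler_pM2l.
  have -> : eps * (2 * survival P (xi 0%N) x) = (r - s) * (q * survival P (xi 0%N) x).
    by rewrite /eps; field.
  by rewrite ler_pM2l// /s; lra.
have -> : r * survival P (stopped_max xi eta) x =
  s * survival P (stopped_max xi eta) x + (r - s) * survival P (stopped_max xi eta) x by ring.
by apply: lerD => //; exact: le_trans h7.
Unshelve. all: by end_near. Qed.
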